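(* Suppose that $f_1,\ldots,f_N$ are strongly convex with convexity parameters $\sigma_1,\ldots,\sigma_N>0$, and that each $\nabla f_i$ ($i=1,\ldots,N$) is Lipschitz continuous with constant $L_i$ (in particular there are no constraints, i.e. $\mathcal{X}_i=\mathbf{R}^{n_i}$ for all $i$). Let $(x_1^*,\ldots,x_N^*,\lambda^* )\in\Omega^*$. If $\gamma>0$ satisfies $$\gamma < \min_{i=2,\ldots, N-1}\left\{\frac{4\sigma_{i}}{3(2N-i)(i-1)\lambda_{\max}(A_{i}^\top A_{i})},\ \frac{4\sigma_{N}}{(3N^2-3N-2)\lambda_{\max}(A_{N}^\top A_{N})}\right\},$$ then the sequence generated by the $N$-block ADMM satisfies $$\gamma\sum_{i=1}^{N-1}\Big\| \sum_{j=i+1}^{N}A_{j}(x_{j}^{*}-x_{j}^{k})\Big\|^{2}+\frac{1}{2\gamma}\|\lambda^*-\lambda^{k}\|^{2}\ \geq\ (1+\delta_2)\left(\gamma\sum_{i=1}^{N-1}\Big\| \sum_{j=i+1}^{N}A_{j}(x_{j}^{*}-x_{j}^{k+1})\Big\|^{2}+\frac{1}{2\gamma}\|\lambda^*-\lambda^{k+1}\|^{2}\right),$$ where $$\delta_2 := \min\left\{\frac{\sigma_1\gamma}{\kappa L_{1}^2}, \delta_3, \delta_4, \delta_5\right\}$$ and $$\delta_3 := \min_{i=2,\ldots,N-1}\left\{\frac{4\sigma_i\gamma - 3\gamma^2 (2N-i)(i-1)\lambda_{\max}(A_i^\top A_i)}{2\gamma^2(2N-i)(i-1)\lambda_{\max}(A_i^\top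 A_i) + 4\kappa L_i^2}\right\},\qquad \delta_4 := \min_{i=1,\ldots,N-1}\left\{\frac{1}{4\kappa \lambda_{\max}(A_{i}^{\top}A_{i})}\right\},$$ $$\delta_5 := \frac{4\sigma_N\gamma-(3N^2-3N-2)\gamma^2\lambda_{\max}(A_N^\top A_N)}{2\gamma^2 N(N-1)\lambda_{\max}(A_N^\top A_N)+4\kappa L_N^2}.$$ The bound on $\gamma$ implies $\delta_2>0$. As a result, $$\Big(\sum_{j=2}^{N}A_{j}x_{j}^{k},\ \sum_{j=3}^{N}A_{j}x_{j}^{k},\ \ldots,\ \sum_{j=N}^{N}A_{j}x_{j}^{k},\ \lambda^k\Big)$$ converges $Q$-linearly.
   Context: Setting. $N\ge 3$; $A_i\in\mathbf{R}^{p\times n_i}$, $b\in\mathbf{R}^p$; $\mathcal{X}_i\subset\mathbf{R}^{n_i}$ are closed convex sets and $\tilde f_i:\mathbf{R}^{n_i}\to\mathbf{R}$ are closed convex functions ($i=1,\ldots,N$). Put $f_i:=\tilde f_i+\mathbf{1}_i$, where $\mathbf{1}_i$ is $0$ on $\mathcal{X}_i$ and $+\infty$ outside. The problem is $\min \sum_{i=1}^N f_i(x_i)$ subject to $\sum_{i=1}^N A_ix_i=b$. $\Omega^*$ is the set of primal-dual optimal solutions, i.e. of $(x_1^*,\ldots,x_N^*,\lambda^* )$ with $A_i^\top\lambda^*\in\partial f_i(x_i^* )$ for $i=1,\ldots,N$ and $\sum_{i=1}^NA_ix_i^*=b$. It is assumed throughout that $\Omega^*\neq\emptyset$. Augmented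 Lagrangian, with penalty parameter $\gamma>0$: $\mathcal{L}_\gamma(x_1,\ldots,x_N;\lambda)=\sum_i f_i(x_i)-\langle\lambda,\sum_iA_ix_i-b\rangle+\frac{\gamma}{2}\|\sum_iA_ix_i-b\|^2$. $N$-block ADMM: given $(x_2^k,\ldots,x_N^k;\lambda^k)$, for successively $i=1,\ldots,N$ set $x_i^{k+1}:=\operatorname{argmin}_{x_i}\mathcal{L}_\gamma(x_1^{k+1},\ldots,x_{i-1}^{k+1},x_i,x_{i+1}^k,\ldots,x_N^k;\lambda^k)$, and then $\lambda^{k+1}:=\lambda^k-\gamma(\sum_{i=1}^NA_ix_i^{k+1}-b)$. The convexity parameter $\sigma_i$ of $f_i$ satisfies $(x-y)^\top(g_i(x)-g_i(y))\ge\sigma_i\|x-y\|^2$ for all $x,y\in\mathcal{X}_i$, where $g_i(x)\in\partial f_i(x)$ and $g_i(y)\in\partial f_i(y)$ are subgradients; $f_i$ is strongly convex if and only if $\sigma_i>0$. $\|\cdot\|$ is the Euclidean norm; $\lambda_{\max}(B),\lambda_{\min}(B)$ are the largest and smallest eigenvalues of a real symmetric matrix $B$, and $\lambda_{\min}^{-1}(B)=1/\lambda_{\min}(B)$. Constant $\kappa>0$. Write $A=[A_1,\ldots,A_N]$, a matrix with $p$ rows. (i) If $A$ has full row rank, $\kappa:=\lambda_{\min}^{-1}(AA^\top)$. (ii) Otherwise let $r=\mathrm{rank}(A)<p$; without loss of generality the first $r$ rows of $A$, forming $A^r=[A_1^r,\ldots,A_N^r]$, are linearly independent, and $A=\begin{pmatrix}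 I\\ B\end{pmatrix}A^r$ with $I\in\mathbf{R}^{r\times r}$ the identity and $B\in\mathbf{R}^{(p-r)\times r}$. Put $E:=(I+B^\top B)A^r$ (which has full row rank) and $\kappa:=\lambda_{\min}^{-1}(EE^\top)\,\lambda_{\max}(I+B^\top B)$. The minimum bounding $\gamma$ is over all the ratios with $i=2,\ldots,N-1$ together with the last listed ratio. $Q$-linear convergence of a sequence $u^k$ to $u^*$: for some norm (here $|(w_1,\ldots,w_{N-1},\lambda)|^2=\gamma\sum_{i=1}^{N-1}\|w_i\|^2+\frac1{2\gamma}\|\lambda\|^2$) there is $\rho\in(0,1)$ with $|u^{k+1}-u^*|\le\rho|u^k-u^*|$ for all $k$; here the limit is the tuple obtained by replacing $x_j^k,\lambda^k$ by $x_j^*,\lambda^*$.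
   Formalization: When A does not have full row rank, λ^0 − λ* is additionally assumed to lie in the column space of A (otherwise its component in ker A^T never changes and the inequality fails); A ≠ 0 and n_i ≥ 1 are assumed so that κ and the eigenvalues are defined. *)

(* Defs.v *)
Set Warnings "-notation-overridden,-notation-incompatible-prefix".
From mathcomp Require Import all_boot all_order all_algebra all_fingroup.
From mathcomp Require Import all_classical all_reals all_analysis.

Set Implicit Arguments.
Unset Strict Implicit.
Unset Printing Implicit Defensive.

Import Order.TTheory GRing.Theory Num.Theory.
Import numFieldNormedType.Exports.

Local Open Scope classical_set_scope.
Local Open Scope ring_scope.

(** ** Euclidean structure, eigenvalues *)

(* The library norm on matrices is the sup norm, hence a separate Euclidean
   norm. *)
Definition dotp (R : realType) (n : nat) (u v : 'cV[R]_n) : R :=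
  (u^T *m v) 0 0.

Definition enorm (R : realType) (n : nat) (u : 'cV[R]_n) : R :=
  Num.sqrt (dotp u u).

(* The set of eigenvalues is finite, and it is nonempty when B is symmetric of
   positive size, so that sup and inf are then a maximum and a minimum. *)
Definition lambda_max (R : realType) (n : nat) (B : 'M[R]_n) : R :=
  sup [set a : R | eigenvalue B a].

Definition lambda_min (R : realType) (n : nat) (B : 'M[R]_n) : R :=
  inf [set a : R | eigenvalue B a].

(** ** Convex functions *)

Definition closed_convex (R : realType) (n : nat) (f : 'cV[R]_n -> R) : Prop :=
  convex_function setT f /\ lower_semicontinuous (fun x => (f x)%:E).

Definition subdifferential (R : realType) (n : nat) (f : 'cV[R]_n -> R)
    (x : 'cV[R]_n) : set 'cV[R]_n :=
  [set g | forall y, f x + dotp g (y - x) <= f y].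

Definition convexity_parameter (R : realType) (n : nat) (f : 'cV[R]_n -> R)
    (sigma : R) : Prop :=
  forall x y gx gy : 'cV[R]_n,
    subdifferential f x gx -> subdifferential f y gy ->
    sigma * enorm (x - y) ^+ 2 <= dotp (x - y) (gx - gy).

Definition gradient (R : realType) (n : nat) (f : 'cV[R]_n -> R)
    (x : 'cV[R]_n) : 'cV[R]_n :=
  \col_j 'D_(delta_mx j 0) f x.

Definition lipschitz_gradient (R : realType) (n : nat) (f : 'cV[R]_n -> R)
    (L : R) : Prop :=
  (forall x, differentiable f x) /\
  forall x y, enorm (gradient f x - gradient f y) <= L * enorm (x - y).

(** ** The N-block problem and ADMM *)

(* Blocks are indexed from 0: the ordinal i stands for block number i + 1. *)

Definition residual (R : realType) (N p : nat) (n : 'I_N -> nat)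
    (A : forall i, 'M[R]_(p, n i)) (b : 'cV[R]_p)
    (x : forall i, 'cV[R]_(n i)) : 'cV[R]_p :=
  \sum_(i < N) A i *m x i - b.

(* The primal-dual optimal solutions (x, lam). *)
Definition Omega_star (R : realType) (N p : nat) (n : 'I_N -> nat)
    (f : forall i, 'cV[R]_(n i) -> R) (A : forall i, 'M[R]_(p, n i))
    (b : 'cV[R]_p) (x : forall i, 'cV[R]_(n i)) (lam : 'cV[R]_p) : Prop :=
  (forall i, subdifferential (f i) (x i) ((A i)^T *m lam)) /\
  \sum_(i < N) A i *m x i = b.

Definition aug_lagrangian (R : realType) (N p : nat) (n : 'I_N -> nat)
    (f : forall i, 'cV[R]_(n i) -> R) (A : forall i, 'M[R]_(p, n i))
    (b : 'cV[R]_p) (gamma : R) (x : forall i, 'cV[R]_(n i)) (lam : 'cV[R]_p)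
    : R :=
  \sum_(i < N) f i (x i) - dotp lam (residual A b x)
  + gamma / 2 * enorm (residual A b x) ^+ 2.

Definition is_argmin (R : realType) (T : Type) (F : T -> R) (z : T) : Prop :=
  forall y, F z <= F y.

(* x 0 at block 1 is never used, as in the algorithm. *)
Definition ADMM (R : realType) (N p : nat) (n : 'I_N -> nat)
    (f : forall i, 'cV[R]_(n i) -> R) (A : forall i, 'M[R]_(p, n i))
    (b : 'cV[R]_p) (gamma : R)
    (x : nat -> forall i, 'cV[R]_(n i)) (lam : nat -> 'cV[R]_p) : Prop :=
  forall k : nat,
    (forall i : 'I_N,
       is_argmin
         (fun z : 'cV[R]_(n i) =>
            aug_lagrangian f A b gamma
              (@dfwith _ _
                 (fun j : 'I_N => if (j < i)%N then x k.+1 j else x k j) i z)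
              (lam k))
         (x k.+1 i)) /\
    lam k.+1 = lam k - gamma *: residual A b (x k.+1).

(** ** Constants *)

(* When the rank r of A is less than p, s moves r linearly independent rows of
   A to the top. The factorization forces Ar to consist of these rows. *)
Definition is_kappa (R : realType) (p m : nat) (A : 'M[R]_(p, m)) (kappa : R)
    : Prop :=
  (row_free A /\ kappa = (lambda_min (A *m A^T))^-1) \/
  (~~ row_free A /\
   exists (s : 'S_p) (Ar : 'M[R]_(\rank A, m))
          (B : 'M[R]_(p - \rank A, \rank A)),
     row_perm s A = castmx (subnKC (rank_leq_row A), erefl m)
                           (col_mx 1%:M B *m Ar) /\
     let C := 1%:M + B^T *m B in
     let E := C *m Ar in
     kappa = (lambda_min (E *m E^T))^-1 * lambda_max C).

Definition first_block (N : nat) (hN : (2 < N)%N) : 'I_N :=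
  Ordinal (leq_trans (isT : (0 < 3)%N) hN).

Definition last_block (N : nat) (hN : (2 < N)%N) : 'I_N :=
  rev_ord (first_block hN).

Definition lmaxAtA (R : realType) (N p : nat) (n : 'I_N -> nat)
    (A : forall i, 'M[R]_(p, n i)) (i : 'I_N) : R :=
  lambda_max ((A i)^T *m A i).

(* (2N - i)(i - 1) for the block number i of the ordinal. *)
Definition coef (N : nat) (i : 'I_N) : nat :=
  ((2 * N - i.+1) * (i.+1 - 1))%N.

(* The range i = 2, ..., N - 1 of block numbers. *)
Definition inner (N : nat) (i : 'I_N) : bool := (0 < i < N.-1)%N.

(* Extended reals: a ratio whose denominator vanishes because A i = 0 is +oo. *)
Definition gamma_max (R : realType) (N p : nat) (hN : (2 < N)%N)
    (n : 'I_N -> nat) (A : forall i, 'M[R]_(p, n i)) (sigma : 'I_N -> R)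
    : \bar R :=
  let iN := last_block hN in
  Order.min
    (\big[Order.min/+oo%E]_(i < N | inner i)
       ((4 * sigma i)%:E / (3 * (coef i)%:R * lmaxAtA A i)%:E)%E)
    ((4 * sigma iN)%:E
       / ((3 * N ^ 2 - 3 * N - 2)%N%:R * lmaxAtA A iN)%:E)%E.

Definition delta3 (R : realType) (N p : nat) (n : 'I_N -> nat)
    (A : forall i, 'M[R]_(p, n i)) (sigma L : 'I_N -> R) (gamma kappa : R)
    : \bar R :=
  \big[Order.min/+oo%E]_(i < N | inner i)
    ((4 * sigma i * gamma - 3 * gamma ^+ 2 * (coef i)%:R * lmaxAtA A i)
     / (2 * gamma ^+ 2 * (coef i)%:R * lmaxAtA A i
        + 4 * kappa * L i ^+ 2))%:E.

(* The division is that of extended reals, as in gamma_max. *)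
Definition delta4 (R : realType) (N p : nat) (n : 'I_N -> nat)
    (A : forall i, 'M[R]_(p, n i)) (kappa : R) : \bar R :=
  \big[Order.min/+oo%E]_(i < N | (i < N.-1)%N)
    (1 / (4 * kappa * lmaxAtA A i)%:E)%E.

Definition delta5 (R : realType) (N p : nat) (hN : (2 < N)%N)
    (n : 'I_N -> nat) (A : forall i, 'M[R]_(p, n i)) (sigma L : 'I_N -> R)
    (gamma kappa : R) : R :=
  let iN := last_block hN in
  (4 * sigma iN * gamma
   - (3 * N ^ 2 - 3 * N - 2)%N%:R * gamma ^+ 2 * lmaxAtA A iN)
  / (2 * gamma ^+ 2 * (N * (N - 1))%N%:R * lmaxAtA A iN
     + 4 * kappa * L iN ^+ 2).

(* The minimum is finite, since its first and last terms are. *)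
Definition delta2 (R : realType) (N p : nat) (hN : (2 < N)%N)
    (n : 'I_N -> nat) (A : forall i, 'M[R]_(p, n i)) (sigma L : 'I_N -> R)
    (gamma kappa : R) : R :=
  let i1 := first_block hN in
  fine
    (Order.min (sigma i1 * gamma / (kappa * L i1 ^+ 2))%:E
      (Order.min (delta3 A sigma L gamma kappa)
        (Order.min (delta4 A kappa)
          (delta5 hN A sigma L gamma kappa)%:E))).

(** ** Convergence *)

(* The sum of A_j x_j over the block numbers j >= i + 2 when the ordinal i
   stands for block number i + 1. *)
Definition tail_sum (R : realType) (N p : nat) (n : 'I_N -> nat)
    (A : forall i, 'M[R]_(p, n i)) (x : forall i, 'cV[R]_(n i))
    (i : 'I_N.-1) : 'cV[R]_p :=
  \sum_(j < N | (i < j)%N) A j *m x j.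

Definition lyapunov (R : realType) (N p : nat) (n : 'I_N -> nat)
    (A : forall i, 'M[R]_(p, n i)) (gamma : R)
    (xs : forall i, 'cV[R]_(n i)) (lams : 'cV[R]_p)
    (x : forall i, 'cV[R]_(n i)) (lam : 'cV[R]_p) : R :=
  gamma * \sum_(i < N.-1) enorm (tail_sum A (fun j => xs j - x j) i) ^+ 2
  + 1 / (2 * gamma) * enorm (lams - lam) ^+ 2.

Definition tail_tuple (R : realType) (N p : nat) (n : 'I_N -> nat)
    (A : forall i, 'M[R]_(p, n i)) (x : forall i, 'cV[R]_(n i))
    (lam : 'cV[R]_p) : {ffun 'I_N.-1 -> 'cV[R]_p} * 'cV[R]_p :=
  ([ffun i => tail_sum A x i], lam).

Definition tuple_norm (R : realType) (M p : nat) (gamma : R)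
    (u : {ffun 'I_M -> 'cV[R]_p} * 'cV[R]_p) : R :=
  Num.sqrt (gamma * \sum_(i < M) enorm (u.1 i) ^+ 2
            + 1 / (2 * gamma) * enorm u.2 ^+ 2).

Definition Q_linear (R : realType) (U : zmodType) (nrm : U -> R)
    (u : nat -> U) (us : U) : Prop :=
  exists rho : R, 0 < rho < 1 /\
    forall k : nat, nrm (u k.+1 - us) <= rho * nrm (u k - us).

(* Main.v *)
(** Write a_j = A_j (x_j - x_j^* ) at step k+1, T_m for the sum of the a_j with
    j >= m, d_m for the increment of T_m between steps k and k+1, and mu for the
    dual error at step k+1. The optimality condition of the i-th subproblem
    reads: A_i^T (lambda^{k+1} + gamma d_{i+1}) is a subgradient of f_i at
    x_i^{k+1}. Strong monotonicity then bounds sum_i sigma_i |x_i - x_i^*|^2 by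
    <T_1, mu> + gamma sum_i <T_i - T_{i+1}, d_{i+1}>, and each cross term is at
    most the decrease of |T_{i+1}|^2 minus |d_{i+1}|^2 / 4 plus
    |T_i|^2 / 2 + |T_{i+1}|^2. The bound on gamma makes the strong convexity
    absorb the last two squares. The reserve |d_{i+1}|^2 / 4 and the Lipschitz
    bounds control A_i^T mu, hence mu, through |mu|^2 <= kappa |A^T mu|^2. *)
Require Import Defs.
From mathcomp Require Import all_boot all_order all_algebra all_fingroup.
From mathcomp Require Import all_classical all_reals all_analysis.
From mathcomp Require Import ring lra zify.

Set Implicit Arguments.
Unset Strict Implicit.
Unset Printing Implicit Defensive.

Import Order.TTheory GRing.Theory Num.Theory.
Import numFieldNormedType.Exports.

Local Open Scope ring_scope.

(** * Euclidean inner product *)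

Lemma dotpE (R : realType) n (u v : 'cV[R]_n) :
  dotp u v = \sum_i u i 0 * v i 0.
Proof. by rewrite /dotp mxE; apply: eq_bigr => i _; rewrite mxE. Qed.

Lemma dotpC (R : realType) n (u v : 'cV[R]_n) : dotp u v = dotp v u.
Proof. by rewrite !dotpE; apply: eq_bigr => i _; rewrite mulrC. Qed.

Lemma dotpDl (R : realType) n (u v w : 'cV[R]_n) :
  dotp (u + v) w = dotp u w + dotp v w.
Proof. by rewrite /dotp raddfD mulmxDl mxE. Qed.

Lemma dotpDr (R : realType) n (u v w : 'cV[R]_n) :
  dotp w (u + v) = dotp w u + dotp w v.
Proof. by rewrite !(dotpC w) dotpDl. Qed.

Lemma dotpZl (R : realType) n a (u v : 'cV[R]_n) :
  dotp (a *: u) v = a * dotp u v.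
Proof. by rewrite /dotp linearZ /= -scalemxAl mxE. Qed.

Lemma dotpZr (R : realType) n a (u v : 'cV[R]_n) :
  dotp u (a *: v) = a * dotp u v.
Proof. by rewrite dotpC dotpZl dotpC. Qed.

Lemma dotpNl (R : realType) n (u v : 'cV[R]_n) : dotp (- u) v = - dotp u v.
Proof. by rewrite -scaleN1r dotpZl mulN1r. Qed.

Lemma dotpNr (R : realType) n (u v : 'cV[R]_n) : dotp u (- v) = - dotp u v.
Proof. by rewrite dotpC dotpNl dotpC. Qed.

Lemma dotp0l (R : realType) n (u : 'cV[R]_n) : dotp 0 u = 0.
Proof. by rewrite -(scale0r 0) dotpZl mul0r. Qed.

Lemma dotp_suml (R : realType) n (I : Type) (r : seq I) (P : pred I)
    (F : I -> 'cV[R]_n) v :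
  dotp (\sum_(i <- r | P i) F i) v = \sum_(i <- r | P i) dotp (F i) v.
Proof.
by apply: (big_morph (fun u => dotp u v)) => [u w|]; rewrite (dotpDl, dotp0l).
Qed.

Lemma dotp_sumr (R : realType) n (I : Type) (r : seq I) (P : pred I)
    (F : I -> 'cV[R]_n) v :
  dotp v (\sum_(i <- r | P i) F i) = \sum_(i <- r | P i) dotp v (F i).
Proof. by rewrite dotpC dotp_suml; apply: eq_bigr => i _; rewrite dotpC. Qed.

Definition dotp_lin :=
  (dotpDl, dotpDr, dotpNl, dotpNr, dotpZl, dotpZr).

Lemma dotp_mulmxl (R : realType) m n (A : 'M[R]_(m, n)) u v :
  dotp (A *m u) v = dotp u (A^T *m v).
Proof. by rewrite /dotp trmx_mul mulmxA. Qed.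

Lemma dotp_mulmxr (R : realType) m n (A : 'M[R]_(m, n)) u v :
  dotp u (A *m v) = dotp (A^T *m u) v.
Proof. by rewrite dotp_mulmxl trmxK. Qed.

Lemma dotp_ge0 (R : realType) n (u : 'cV[R]_n) : 0 <= dotp u u.
Proof. by rewrite dotpE sumr_ge0 // => i _; rewrite -expr2 sqr_ge0. Qed.

Lemma dotp_eq0 (R : realType) n (u : 'cV[R]_n) : (dotp u u == 0) = (u == 0).
Proof.
apply/eqP/eqP => [|->]; last exact: dotp0l.
rewrite dotpE => /eqP; rewrite psumr_eq0 => [|i _]; last by rewrite -expr2 sqr_ge0.
move=> /allP u0; apply/colP => i; rewrite mxE.
by have := u0 i (mem_index_enum _); rewrite -expr2 sqrf_eq0 => /eqP.
Qed.

Lemma dotp_gt0 (R : realType) n (u : 'cV[R]_n) : (0 < dotp u u) = (u != 0).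
Proof. by rewrite lt_def dotp_ge0 andbT dotp_eq0. Qed.

Lemma enorm_sqr (R : realType) n (u : 'cV[R]_n) : enorm u ^+ 2 = dotp u u.
Proof. by rewrite /enorm sqr_sqrtr // dotp_ge0. Qed.

Lemma enorm_ge0 (R : realType) n (u : 'cV[R]_n) : 0 <= enorm u.
Proof. exact: sqrtr_ge0. Qed.

(** * Extreme eigenvalues of symmetric matrices *)

(* Testing nonnegativity on v + t w with w = Q v and t small negative leaves
   no room for w. *)
Lemma psd_kernel (R : realType) n (Q : 'M[R]_n) (v : 'cV[R]_n) :
  Q^T = Q -> (forall u, 0 <= dotp u (Q *m u)) -> dotp v (Q *m v) = 0 ->
  Q *m v = 0.
Proof.
move=> Qs Qp Qv; apply/eqP; rewrite -dotp_eq0; set w := Q *m v.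
set d := dotp w w; set c := dotp w (Q *m w).
have c0 : 0 <= c by exact: Qp.
apply/negPn/negP => dn0; have d0 : 0 < d by rewrite lt_def dn0 dotp_ge0.
have vw : dotp v (Q *m w) = d by rewrite dotp_mulmxr Qs.
(* The [+ 1] keeps the denominator positive when [c = 0]. With [s = d / (c + 1)] the form equals
   [s * (s * c - 2 * d)], which is negative because [s * c < d]. *)
have := Qp (v - (d / (c + 1)) *: w).
rewrite mulmxBr -scalemxAr !dotp_lin Qv -/w -/c -/d vw; set s := d / (c + 1).
have c1 : 0 < c + 1 by rewrite ltr_wpDl.
have sc : s * (c + 1) = d by rewrite /s divfK // gt_eqF.
have s0 : 0 < s by rewrite divr_gt0.
have -> : 0 - s * d + (- (s * d) - s * - (s * c)) = s * (s * c - 2 * d) by ring.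
rewrite pmulr_rge0 // => h; clear Qs; nra.
Qed.

Lemma continuous_sum (R : realType) (T : topologicalType) (I : Type)
    (r : seq I) (F : I -> T -> R) :
  (forall i, continuous (F i)) -> continuous (fun x => \sum_(i <- r) F i x).
Proof.
move=> cF x; apply: cvg_big => [|i _]; last exact: cF.
exact: add_continuous.
Qed.

Lemma compact_unit_sphere (R : realType) n :
  compact [set v : 'rV[R]_n | (v *m v^T) 0 0 = 1]%classic.
Proof.
have sqE (v : 'rV[R]_n) : (v *m v^T) 0 0 = \sum_j v 0 j ^+ 2.
  by rewrite mxE; apply: eq_bigr => j _; rewrite mxE.
apply: bounded_closed_compact.
  exists 1; split; first exact: num_real.
  move=> M M1 v /= v1; apply: le_trans (ltW M1).
  rewrite [`|v|]mx_normrE; apply/bigmax_leP; split => // -[i j] _ /=.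
  rewrite ord1 -(@expr_le1 _ 2) // real_normK ?num_real // -v1 sqE.
  by rewrite (bigD1 j) //= lerDl sumr_ge0 // => ? _; rewrite sqr_ge0.
have -> : [set v : 'rV[R]_n | (v *m v^T) 0 0 = 1]%classic =
    ((fun v : 'rV[R]_n => \sum_j v 0 j ^+ 2) @^-1` [set 1])%classic.
  by apply/seteqP; split => v /=; rewrite sqE.
apply: preimage_closed; last exact: closed_eq.
move=> v _; apply: continuous_sum => j {}v.
apply: (@continuous_comp _ _ _ (fun v : 'rV[R]_n => v 0 j) (fun x : R => x ^+ 2)).
  exact: coord_continuous.
exact: exprn_continuous.
Qed.

(** The form attains a minimum [q c] on the compact unit sphere. Then [B - q c] is positive
    semidefinite and its form vanishes at [c], so [psd_kernel] makes [c] an eigenvector. *)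
Lemma rayleigh_min (R : realType) n (B : 'M[R]_n) : (0 < n)%N -> B^T = B ->
  exists2 a, eigenvalue B a & forall u, a * dotp u u <= dotp u (B *m u).
Proof.
move=> n0 Bs.
pose q (v : 'rV[R]_n) := (v *m B *m v^T) 0 0.
have [c] : exists2 c, c \in [set v : 'rV[R]_n | (v *m v^T) 0 0 = 1]%classic &
    forall t, t \in [set v : 'rV[R]_n | (v *m v^T) 0 0 = 1]%classic -> q c <= q t.
  apply: EVT_min_rV.
  - exists (delta_mx 0 (Ordinal n0)) => /=.
    by rewrite trmx_delta mul_delta_mx mxE !eqxx.
  - exact: compact_unit_sphere.
  apply: continuous_subspaceT => v.
  have -> : q = fun v => \sum_j (\sum_i v 0 i * B i j) * v 0 j.
    apply/funext => w; rewrite /q mxE; apply: eq_bigr => j _.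
    by rewrite !mxE.
  move: v; apply: continuous_sum => j v.
  apply: (@continuousM _ _ (fun v : 'rV[R]_n => \sum_i v 0 i * B i j)
    (fun v : 'rV[R]_n => v 0 j)); last exact: coord_continuous.
  move: v; apply: continuous_sum => i v.
  apply: (@continuousM _ _ (fun v : 'rV[R]_n => v 0 i) (fun=> B i j)).
    exact: coord_continuous.
  exact: cst_continuous.
rewrite inE /= => c1 cmin.
have qE (u : 'cV[R]_n) : q u^T = dotp u (B *m u) by rewrite /q /dotp trmxK mulmxA.
have cE : dotp c^T c^T = 1 by rewrite /dotp trmxK.
have qc : q c = dotp c^T (B *m c^T) by rewrite -qE trmxK.
have ray u : q c * dotp u u <= dotp u (B *m u).
  have [->|u0] := eqVneq u 0; first by rewrite mulmx0 dotp0l mulr0.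
  have d0 : 0 < dotp u u by rewrite dotp_gt0.
  have e0 : enorm u != 0 by rewrite -sqrf_eq0 enorm_sqr gt_eqF.
  have := cmin ((enorm u)^-1 *: u)^T; rewrite inE /= trmxK qE.
  rewrite -[X in X = 1 -> _]/((((enorm u)^-1 *: u)^T *m ((enorm u)^-1 *: u)) 0 0).
  rewrite -[X in X = 1 -> _]/(dotp _ _) -scalemxAr !dotp_lin !mulrA -expr2.
  rewrite exprVn enorm_sqr mulVf ?gt_eqF // => /(_ erefl).
  by rewrite [X in _ <= X -> _]mulrC ler_pdivlMr.
exists (q c) => //.
apply/eigenvalueP; exists c; last first.
  by apply/eqP => c0; move: cE; rewrite c0 trmx0 dotp0l => /eqP; rewrite eq_sym oner_eq0.
suff : (B - (q c)%:M) *m c^T = 0.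
  rewrite mulmxBl mul_scalar_mx => /(congr1 trmx)/eqP.
  rewrite linearB /= trmx_mul linearZ /= trmxK Bs trmx0 subr_eq0 => /eqP //.
apply: psd_kernel.
- by rewrite linearB /= tr_scalar_mx Bs.
- by move=> u; rewrite mulmxBl mul_scalar_mx !dotp_lin subr_ge0.
- by rewrite mulmxBl mul_scalar_mx !dotp_lin cE -qc mulr1 subrr.
Qed.

Lemma eigenvalue_ge (R : realType) n (B : 'M[R]_n) a c :
  (forall u, a * dotp u u <= dotp u (B *m u)) -> B^T = B ->
  eigenvalue B c -> a <= c.
Proof.
move=> h Bs /eigenvalueP[v vB v0].
have v0' : v^T != 0 by rewrite -trmx0 (inj_eq trmx_inj).
have := h v^T; rewrite -[B in B *m _]Bs -trmx_mul vB linearZ /= dotpZr.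
by rewrite ler_pM2r // dotp_gt0.
Qed.

Lemma lambda_min_spec (R : realType) n (B : 'M[R]_n) :
  (0 < n)%N -> B^T = B ->
  eigenvalue B (lambda_min B) /\
  forall u, lambda_min B * dotp u u <= dotp u (B *m u).
Proof.
move=> n0 Bs; have [a Ba ha] := rayleigh_min n0 Bs.
suff -> : lambda_min B = a by [].
apply/eqP; rewrite eq_le; apply/andP; split.
  by apply: ge_inf => //; exists a => c /= Bc; exact: eigenvalue_ge Bc.
by apply: lb_le_inf; [exists a|move=> c /= Bc; exact: eigenvalue_ge Bc].
Qed.

Lemma lambda_min_gt0 (R : realType) n (B : 'M[R]_n) :
  (0 < n)%N -> B^T = B -> (forall u, u != 0 -> 0 < dotp u (B *m u)) ->
  0 < lambda_min B.
Proof.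
move=> n0 Bs Bp; have [/eigenvalueP[v vB v0] _] := lambda_min_spec n0 Bs.
have v0' : v^T != 0 by rewrite -trmx0 (inj_eq trmx_inj).
have := Bp _ v0'; rewrite -[B in B *m _]Bs -trmx_mul vB linearZ /= dotpZr.
by rewrite pmulr_lgt0 // dotp_gt0.
Qed.

(** Follows from [rayleigh_min] for [- B], whose eigenvalues are the opposites of those of [B]. *)
Lemma lambda_max_ge (R : realType) n (B : 'M[R]_n) u :
  (0 < n)%N -> B^T = B -> dotp u (B *m u) <= lambda_max B * dotp u u.
Proof.
move=> n0 Bs.
have Ns : (- B)^T = - B by rewrite linearN /= Bs.
have [a Ba ha] := rayleigh_min n0 Ns.
have eigN (c : R) : eigenvalue B c -> eigenvalue (- B) (- c).
  move=> /eigenvalueP[v vB v0]; apply/eigenvalueP; exists v => //.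
  by rewrite mulmxN vB scaleNr.
have Ba' : eigenvalue B (- a).
  move: Ba => /eigenvalueP[v vB v0]; apply/eigenvalueP; exists v => //.
  by rewrite scaleNr -vB mulmxN opprK.
have le_max : - a <= lambda_max B.
  apply: ub_le_sup => //; exists (- a) => c /= /eigN Bc.
  by rewrite lerNr; exact: eigenvalue_ge Bc.
apply: le_trans (ler_wpM2r (dotp_ge0 u) le_max).
by have := ha u; rewrite mulNmx dotpNr mulNr lerNr.
Qed.

Lemma dotp_mulmx_le (R : realType) m n (A : 'M[R]_(m, n)) u :
  (0 < n)%N -> dotp (A *m u) (A *m u) <= lambda_max (A^T *m A) * dotp u u.
Proof.
move=> n0; rewrite dotp_mulmxl mulmxA; apply: lambda_max_ge => //.
by rewrite trmx_mul trmxK.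
Qed.

Lemma lambda_max_gram_ge0 (R : realType) m n (A : 'M[R]_(m, n)) :
  (0 < n)%N -> 0 <= lambda_max (A^T *m A).
Proof.
move=> n0; have := dotp_mulmx_le A (delta_mx (Ordinal n0) 0) n0.
set d := delta_mx _ _ => /(le_trans (dotp_ge0 _)).
rewrite pmulr_lge0 // dotp_gt0; apply/eqP => /matrixP/(_ (Ordinal n0) 0).
by rewrite !mxE !eqxx => /eqP; rewrite oner_eq0.
Qed.

Lemma dotp_tr_mulmx_ge (R : realType) r m (E : 'M[R]_(r, m)) u :
  (0 < r)%N ->
  lambda_min (E *m E^T) * dotp u u <= dotp (E^T *m u) (E^T *m u).
Proof.
move=> r0; rewrite dotp_mulmxl trmxK mulmxA.
by apply: (lambda_min_spec r0 _).2; rewrite trmx_mul trmxK.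
Qed.

Lemma lambda_min_gram_gt0 (R : realType) r m (E : 'M[R]_(r, m)) :
  (0 < r)%N -> row_free E -> 0 < lambda_min (E *m E^T).
Proof.
move=> r0 Ef; apply: lambda_min_gt0 => // [|u u0].
  by rewrite trmx_mul trmxK.
rewrite -mulmxA dotp_mulmxr dotp_gt0 -(inj_eq trmx_inj).
by rewrite trmx_mul trmxK trmx0 mulmx_free_eq0 // -trmx0 (inj_eq trmx_inj).
Qed.

(** * The constant kappa *)

(** The sizes [p] and [q] are independent variables so that [e] can be eliminated; in [is_kappa] the
    size [q] itself mentions [p]. *)
Lemma row_perm_castmx (R : realType) p q m (e : q = p) (A : 'M[R]_(p, m))
    (M : 'M[R]_(q, m)) (s : 'S_p) :
  row_perm s A = castmx (e, erefl m) M ->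
  exists P : 'M[R]_(q, p), P *m P^T = 1%:M /\ A = P^T *m M.
Proof.
case: p / e A s => A s; rewrite castmx_id row_permE => <-.
exists (perm_mx s); rewrite tr_perm_mx -perm_mxM mulgV perm_mx1; split => //.
by rewrite mulmxA -perm_mxM mulVg perm_mx1 mul1mx.
Qed.

(** In the rank-deficient case [A^T] has a kernel, whence the restriction to [mu = A *m w]. With
    [y = Ar *m w], the square of [mu] is the form of [C] at [y], at most [lambda_max C] times that
    of [y], while [A^T *m mu = E^T *m y] and [E *m E^T] is positive definite. The condition [A != 0]
    gives these matrices a positive size, hence eigenvalues. *)
Lemma is_kappa_spec (R : realType) p m (A : 'M[R]_(p, m)) kappa :
  A != 0 -> is_kappa A kappa ->
  0 < kappa /\
  forall mu, (~~ row_free A -> exists w, mu = A *m w) ->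
    dotp mu mu <= kappa * dotp (A^T *m mu) (A^T *m mu).
Proof.
move=> A0; have rA0 : (0 < \rank A)%N by rewrite lt0n mxrank_eq0.
have p0 : (0 < p)%N := leq_trans rA0 (rank_leq_row A).
case=> [[Af ->]|[Af [s [Ar [B [sA kE]]]]]].
  have l0 := lambda_min_gram_gt0 p0 Af.
  split=> [|mu _]; first by rewrite invr_gt0.
  by rewrite mulrC ler_pdivlMr // mulrC; exact: dotp_tr_mulmx_ge.
move: kE; set C := 1%:M + _; set E := C *m Ar => kE.
set G := col_mx 1%:M B.
have CE : C = G^T *m G by rewrite /G tr_col_mx mul_row_col trmx1 mul1mx.
have Cs : C^T = C by rewrite CE trmx_mul trmxK.
have dC u : dotp u u <= dotp u (C *m u).
  by rewrite mulmxDl mul1mx dotpDr -mulmxA dotp_mulmxr trmxK lerDl dotp_ge0.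
have Cu : C \in unitmx.
  rewrite -row_free_unit -kermx_eq0; apply/eqP/row_matrixP => i.
  rewrite row0; apply/eqP; rewrite -(inj_eq trmx_inj) trmx0 -dotp_eq0.
  rewrite eq_le dotp_ge0 andbT; apply: le_trans (dC _) _.
  rewrite -[C in C *m _]Cs -trmx_mul -row_mul mulmx_ker row0 trmx0.
  by rewrite dotpC dotp0l.
have nG u : dotp (G *m u) (G *m u) = dotp u (C *m u).
  by rewrite dotp_mulmxl CE mulmxA.
have [P [PtP AE]] : exists P : 'M[R]_(_, p),
    P *m P^T = 1%:M /\ A = P^T *m (G *m Ar).
  exact: row_perm_castmx sA.
have AtA : A^T *m A = (G *m Ar)^T *m (G *m Ar).
  by rewrite {1 2}AE trmx_mul trmxK mulmxA -[_ *m P *m _]mulmxA PtP mulmx1.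
have sAE u : dotp (A *m u) (A *m u) = dotp (G *m (Ar *m u)) (G *m (Ar *m u)).
  by rewrite dotp_mulmxl !mulmxA AtA -mulmxA -dotp_mulmxl.
have sAT w : A^T *m (A *m w) = Ar^T *m (G^T *m (G *m (Ar *m w))).
  by rewrite mulmxA AtA trmx_mul !mulmxA.
(* [A] factors through [Ar], so the rank of [Ar] is at least that of [A], which is its number of
   rows. *)
have Arf : row_free Ar.
  rewrite /row_free eqn_leq rank_leq_row /= {1}AE.
  by rewrite mulmxA mxrankM_maxr.
have Ef : row_free E.
  by rewrite /row_free mxrankMfree // mxrank_unit.
have l0 := lambda_min_gram_gt0 rA0 Ef.
have M1 : 1 <= lambda_max C.
  have n0 : delta_mx (Ordinal rA0) 0 != 0 :> 'cV[R]__.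
    apply/eqP => /matrixP/(_ (Ordinal rA0) 0).
    by rewrite !mxE !eqxx => /eqP; rewrite oner_eq0.
  have := le_trans (dC _) (lambda_max_ge (delta_mx (Ordinal rA0) 0) rA0 Cs).
  by rewrite -{1}[dotp _ _]mul1r ler_pM2r // dotp_gt0.
have M0 : 0 < lambda_max C by apply: lt_le_trans M1.
split=> [|mu /(_ Af)[w ->]]; first by rewrite kE mulr_gt0 // invr_gt0.
rewrite sAE sAT nG.
have -> : Ar^T *m (G^T *m (G *m (Ar *m w))) = E^T *m (Ar *m w).
  by rewrite /E trmx_mul Cs CE !mulmxA.
apply: le_trans (lambda_max_ge _ rA0 Cs) _.
rewrite kE [_^-1 * _]mulrC -mulrA ler_pM2l // mulrC ler_pdivlMr // mulrC.
exact: dotp_tr_mulmx_ge.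
Qed.

(** * Subgradients, gradients and minimizers *)

Lemma closed_convex_segment (R : realType) n (f : 'cV[R]_n -> R) x y t :
  closed_convex f -> 0 <= t -> t <= 1 ->
  f (x + t *: (y - x)) <= f x + t * (f y - f x).
Proof.
move=> [cf _] t0 t1.
have := cf (Itv01 t0 t1) y x (mem_setT _) (mem_setT _).
rewrite convRE /conv /= => h.
have -> : x + t *: (y - x) = t *: y + (1 - t) *: x.
  by rewrite scalerBr scalerBl scale1r addrCA.
by apply: le_trans h _; rewrite /unstable.onem; lra.
Qed.

(** The derivative is also the limit of the quotients as [t] tends to 0 from the right, so
    increments with [t] in (0, 1] suffice. *)
Lemma derive_ge (R : realType) n (f : 'cV[R]_n -> R) a v c :
  derivable f a v -> (forall t, 0 < t -> t <= 1 -> t * c <= f (a + t *: v) - f a) ->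
  c <= 'D_v f a.
Proof.
move=> df h; have /cvg_dnbhs_at_right df' := df.
apply: (cvgr_to_ge df'); near=> t.
have t0 : 0 < t by near: t; exact: nbhs_right_gt.
have t1 : t <= 1 by near: t; exact: nbhs_right_le.
by rewrite /= -[_ *: _]/(_ * _) ler_pdivlMl // [t *: v + a]addrC h.
Unshelve. all: by end_near.
Qed.

Lemma derive_le (R : realType) n (f : 'cV[R]_n -> R) a v c :
  derivable f a v -> (forall t, 0 < t -> t <= 1 -> f (a + t *: v) - f a <= t * c) ->
  'D_v f a <= c.
Proof.
move=> df h; rewrite -lerN2 -deriveN //.
apply: derive_ge => [|t t0 t1]; first exact: derivableN.
by rewrite mulrN -opprD lerN2 h.
Qed.

Lemma derive_dotp_gradient (R : realType) n (f : 'cV[R]_n -> R) x v :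
  differentiable f x -> 'D_v f x = dotp (gradient f x) v.
Proof.
move=> df; rewrite deriveE // {1}(matrix_sum_delta v) linear_sum dotpE /=.
apply: eq_bigr => i _; rewrite big_ord1 linearZ /= -deriveE //.
by rewrite mxE mulrC.
Qed.

Lemma gradient_subdifferential (R : realType) n (f : 'cV[R]_n -> R) x :
  closed_convex f -> differentiable f x -> subdifferential f x (gradient f x).
Proof.
move=> cf df y /=; rewrite -derive_dotp_gradient // -lerBrDl.
apply: derive_le => [|t t0 t1]; first exact: diff_derivable.
by rewrite lerBlDl; apply: closed_convex_segment => //; exact: ltW.
Qed.

(** The subgradient inequality bounds [dotp g v] by the derivative along [v]; using [v] and [- v]
    together forces equality. *)
Lemma subdifferential_gradient (R : realType) n (f : 'cV[R]_n -> R) x g :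
  differentiable f x -> subdifferential f x g -> gradient f x = g.
Proof.
move=> df fg.
have le v : dotp g v <= dotp (gradient f x) v.
  rewrite -derive_dotp_gradient //.
  apply: derive_ge => [|t t0 t1]; first exact: diff_derivable.
  by have := fg (x + t *: v); rewrite [x + _ - x]addrAC subrr add0r dotpZr lerBrDl.
have ev v : dotp (gradient f x - g) v = 0.
  apply/eqP; rewrite eq_le; have := le v; have := le (- v).
  by rewrite !dotp_lin lerN2 subr_le0 subr_ge0 => -> ->.
by apply/eqP; rewrite -subr_eq0 -dotp_eq0 ev.
Qed.

(* Comparing z with z + t (y - z) and letting t tend to 0. *)
Lemma argmin_subdifferential (R : realType) n p (f : 'cV[R]_n -> R)
    (A : 'M[R]_(p, n)) (c lam : 'cV[R]_p) (gamma : R) z :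
  closed_convex f -> 0 <= gamma ->
  is_argmin (fun y => f y - dotp lam (A *m y + c)
    + gamma / 2 * enorm (A *m y + c) ^+ 2) z ->
  subdifferential f z (A^T *m (lam - gamma *: (A *m z + c))).
Proof.
move=> cf g0 zmin y /=; set v := y - z.
rewrite -dotp_mulmxr.
have [e eE] : exists e, A *m z + c = e by exists (A *m z + c).
have [d dE] : exists d, A *m v = d by exists (A *m v).
rewrite eE dE.
suff H t : 0 < t -> t <= 1 ->
    dotp (lam - gamma *: e) d - (f y - f z) <= t * (gamma / 2 * dotp d d).
  rewrite -lerBrDl -subr_le0.
  set a := _ - _ in H *; set b := gamma / 2 * _ in H.
  have b0 : 0 <= b by rewrite mulr_ge0 ?dotp_ge0 // divr_ge0.
  rewrite leNgt; apply/negP => a0.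
  (* This [s] satisfies [s * (b + 1) <= a / 2], so [s * b < a], against [H] at [s]. *)
  pose s := Num.min 1 (a / (2 * (b + 1))).
  have s0 : 0 < s by rewrite lt_min ltr01 divr_gt0 //; lra.
  have s1 : s <= 1 by rewrite ge_min lexx.
  have sa : s * (2 * (b + 1)) <= a.
    by rewrite -ler_pdivlMr; [rewrite ge_min lexx orbT|lra].
  have := H s s0 s1; clear -a0 sa b0 s0; nra.
move=> t0 t1.
have := closed_convex_segment z y cf (ltW t0) t1.
have := zmin (z + t *: v); rewrite -/v /=.
have -> : A *m (z + t *: v) + c = e + t *: d.
  by rewrite mulmxDr -scalemxAr dE -eE addrAC.
rewrite eE !enorm_sqr !dotp_lin [dotp d e]dotpC => h1 h2.
rewrite -(ler_pM2l t0).
by clear zmin; lra.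
Qed.

(** * Tail sums and the descent of the energy in one step *)

(** The index is a natural number, so that [i.+1] always makes sense and the tail at [N] is 0. *)
Definition tail (R : realType) (N p : nat) (a : 'I_N -> 'cV[R]_p) (m : nat) :
  'cV[R]_p := \sum_(j < N | (m <= j)%N) a j.

Lemma tail_rec (R : realType) (N p : nat) (a : 'I_N -> 'cV[R]_p) (i : 'I_N) :
  tail a i = a i + tail a i.+1.
Proof.
rewrite /tail (bigD1 i) //=; congr (_ + _); apply: eq_bigl => j.
by rewrite ltn_neqAle andbC eq_sym.
Qed.

Lemma tail_oversize (R : realType) (N p : nat) (a : 'I_N -> 'cV[R]_p) m :
  (N <= m)%N -> tail a m = 0.
Proof.
move=> Nm; rewrite /tail big_pred0 // => j.
by apply/negbTE; rewrite -ltnNge (leq_trans (ltn_ord j)).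
Qed.

Lemma tail0 (R : realType) (N p : nat) (a : 'I_N -> 'cV[R]_p) :
  tail a 0 = \sum_i a i.
Proof. by []. Qed.

(** Expand the square and bound each product by half the sum of the two squares. *)
Lemma dotp_sum_le_card (R : realType) (I : finType) (P : pred I) n
    (a : I -> 'cV[R]_n) :
  dotp (\sum_(i | P i) a i) (\sum_(i | P i) a i)
  <= #|P|%:R * \sum_(i | P i) dotp (a i) (a i).
Proof.
rewrite dotp_suml.
pose c := \sum_(i | P i) dotp (a i) (a i).
have cst (x : R) : \sum_(j | P j) x = #|P|%:R * x by rewrite sumr_const mulr_natl.
have -> : #|P|%:R * c = \sum_(i | P i) \sum_(j | P j)
    (dotp (a i) (a i) / 2 + dotp (a j) (a j) / 2).
  under eq_bigr do rewrite big_split /= cst -mulr_suml -/c.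
  by rewrite big_split /= cst -mulr_sumr -mulr_suml -/c; field.
apply: ler_sum => i _; rewrite dotp_sumr; apply: ler_sum => j _.
by have := dotp_ge0 (a i - a j); rewrite !dotp_lin [dotp (a j) _]dotpC; lra.
Qed.

(** For [j] the value of an ordinal the right-hand side is its [coef]; the factor 2 avoids halves in
    [nat]. *)
Lemma sum_coef N j : (j <= N)%N ->
  (2 * \sum_(i < j) (N - i.+1) = (2 * N - j.+1) * j)%N.
Proof.
elim: j => [|j IH] jN; first by rewrite big_ord0 !muln0.
by rewrite big_ord_recr /= mulnDr IH ?(ltnW jN) //; nia.
Qed.

Lemma card_ord_gt N i : #|[pred j : 'I_N | (i < j)%N]| = (N - i.+1)%N.
Proof.
rewrite -sum1_card -(big_geq_mkord i.+1 N xpredT (fun=> 1%N)).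
by rewrite sum_nat_const_nat muln1.
Qed.

(* Exchanging the order of summation, the coefficient of the j-th square is
   the sum of N - i - 1 over i < j, that is coef j / 2. *)
Lemma sum_tail_le (R : realType) (N p : nat) (a : 'I_N -> 'cV[R]_p) :
  \sum_(0 <= i < N) dotp (tail a i.+1) (tail a i.+1)
  <= \sum_j (coef j)%:R / 2 * dotp (a j) (a j).
Proof.
rewrite big_mkord.
have -> : \sum_j (coef j)%:R / 2 * dotp (a j) (a j) =
    \sum_(i < N) \sum_(j < N | (i < j)%N) (N - i.+1)%:R * dotp (a j) (a j).
  rewrite (exchange_big_dep predT) //=; apply: eq_bigr => j _.
  rewrite -mulr_suml; congr (_ * _).
  rewrite /coef -natr_sum subn1 -(sum_coef (ltnW (ltn_ord j))).
  rewrite natrM mulrC mulKf //.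
  by rewrite (big_ord_widen _ (fun i => N - i.+1)%N (ltnW (ltn_ord j))).
apply: ler_sum => i _; apply: le_trans (dotp_sum_le_card _ _) _.
by rewrite -mulr_sumr card_ord_gt.
Qed.

(** With [w = A^T *m u] and [l] the largest eigenvalue, expand the square of [l *: u - A *m w], use
    [dotp_mulmx_le] on [A *m w], and divide by [l]. If [l = 0] then [A *m w = 0], hence [w = 0]. *)
Lemma dotp_tr_mulmx_le (R : realType) m n (A : 'M[R]_(m, n)) u :
  (0 < n)%N ->
  dotp (A^T *m u) (A^T *m u) <= lambda_max (A^T *m A) * dotp u u.
Proof.
move=> n0; set w := A^T *m u; set l := lambda_max _.
have l0 : 0 <= l by exact: lambda_max_gram_ge0.
have wE : dotp u (A *m w) = dotp w w by rewrite dotp_mulmxr.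
have h1 : dotp (A *m w) (A *m w) <= l * dotp w w by exact: dotp_mulmx_le.
have h2 := dotp_ge0 (l *: u - A *m w).
rewrite !dotp_lin [dotp (A *m w) u]dotpC wE in h2.
have [l00|ln0] := eqVneq l 0.
  rewrite l00 !mul0r in h1 *.
  have /eqP : dotp (A *m w) (A *m w) == 0 by rewrite eq_le h1 dotp_ge0.
  by move=> /eqP; rewrite dotp_eq0 => /eqP Aw; rewrite -wE Aw dotpC dotp0l.
have lp : 0 < l by rewrite lt_def ln0.
by rewrite -(ler_pM2l lp); lra.
Qed.

(* The difference of the two sides is the sum of the squares of b + c and
   u - b + c, up to positive factors. *)
Lemma cross_term_le (R : realType) n (u b c : 'cV[R]_n) :
  dotp (u - b) (b - c) <= dotp c c - dotp b b - dotp (b - c) (b - c) / 4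
    + (dotp u u / 2 + dotp b b).
Proof.
have := dotp_ge0 (u - b + c); have := dotp_ge0 (b + c).
rewrite !dotp_lin [dotp c b]dotpC [dotp b u]dotpC [dotp c u]dotpC; lra.
Qed.

(* T m and Tk m stand for the sums of the blocks >= m of the errors A_j (x_j -
   xs_j) at steps k.+1 and k. *)
Lemma admm_energy (R : realType) (M p : nat) (gamma : R) (T Tk : nat -> 'cV[R]_p)
    (mu mu' : 'cV[R]_p) :
  0 < gamma -> mu' = mu - gamma *: T 0%N ->
  dotp (T 0%N) mu' + gamma * \sum_(0 <= i < M) dotp (T i - T i.+1) (T i.+1 - Tk i.+1)
  <= (dotp mu mu - dotp mu' mu') / (2 * gamma)
     + gamma * (\sum_(0 <= i < M) dotp (Tk i.+1) (Tk i.+1)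
       + \sum_(0 <= i < M) dotp (T i.+1) (T i.+1) / 2 - dotp (T M) (T M) / 2
       - \sum_(0 <= i < M) dotp (T i.+1 - Tk i.+1) (T i.+1 - Tk i.+1) / 4).
Proof.
move=> g0 muE.
have -> : (dotp mu mu - dotp mu' mu') / (2 * gamma)
    = dotp (T 0%N) mu' + gamma / 2 * dotp (T 0%N) (T 0%N).
  have -> : mu = mu' + gamma *: T 0%N by rewrite muE subrK.
  rewrite !dotp_lin [dotp (T 0%N) mu']dotpC; field; lra.
set d := dotp (T 0%N) (T 0%N).
(* Each cross term leaves half the square of [T i]. Shifting the index to [i.+1] produces the
   boundary terms [d / 2], paid for by the dual identity above, and minus half the square of
   [T M]. *)
suff H : \sum_(0 <= i < M) dotp (T i - T i.+1) (T i.+1 - Tk i.+1)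
  <= d / 2 + (\sum_(0 <= i < M) dotp (Tk i.+1) (Tk i.+1)
       + \sum_(0 <= i < M) dotp (T i.+1) (T i.+1) / 2 - dotp (T M) (T M) / 2
       - \sum_(0 <= i < M) dotp (T i.+1 - Tk i.+1) (T i.+1 - Tk i.+1) / 4).
  by have := ler_wpM2l (ltW g0) H; lra.
elim: M => [|M IH]; first by rewrite !big_geq // -/d; lra.
have := cross_term_le (T M) (T M.+1) (Tk M.+1).
rewrite !big_nat_recr //=; lra.
Qed.

Lemma sum_nat_predr (R : realType) N (F : nat -> R) : (0 < N)%N ->
  \sum_(i < N) F i = \sum_(0 <= i < N.-1) F i + F N.-1.
Proof. by case: N => // M _; rewrite -(big_mkord xpredT) big_nat_recr. Qed.

Definition energy (R : realType) (N p : nat) (gamma : R) (T : nat -> 'cV[R]_p)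
    (mu : 'cV[R]_p) : R :=
  gamma * (\sum_(0 <= i < N.-1) dotp (T i.+1) (T i.+1))
  + dotp mu mu / (2 * gamma).

(* 4 / gamma times the coefficient of [|A_j (x_j - xs_j)|^2] that the strong
   convexity of block j has to absorb. *)
Definition weight (R : realType) (N : nat) (delta : R) (j : 'I_N) : R :=
  (3 + 2 * delta) * (coef j)%:R - 2 * (j == N.-1 :> nat)%:R.

(** One step reduced to linear algebra: [dx] and [dy] are the primal errors at the new and the old
    step, [mu'] and [mu] the dual ones, and [v i] is the difference of the subgradients at the new
    iterate and at the optimum. The last three hypotheses before the conclusion are what the choice
    of [delta] and [gamma] has to provide. *)
Lemma admm_descent (R : realType) (N p : nat) (n : 'I_N -> nat)
    (A : forall i, 'M[R]_(p, n i)) (sigma L : 'I_N -> R)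
    (gamma kappa delta : R) (dx dy v : forall i, 'cV[R]_(n i))
    (mu mu' : 'cV[R]_p) :
  let T := tail (fun j => A j *m dx j) in
  let Tk := tail (fun j => A j *m dy j) in
  (0 < N)%N -> (forall i, 0 < n i)%N -> 0 < gamma -> 0 < kappa -> 0 <= delta ->
  mu' = mu - gamma *: T 0%N ->
  (forall i, v i = (A i)^T *m (mu' + gamma *: (T i.+1 - Tk i.+1))) ->
  (forall i, sigma i * dotp (dx i) (dx i) <= dotp (dx i) (v i)) ->
  (forall i, dotp (v i) (v i) <= L i ^+ 2 * dotp (dx i) (dx i)) ->
  dotp mu' mu' <= kappa * \sum_i dotp ((A i)^T *m mu') ((A i)^T *m mu') ->
  (forall i : 'I_N, (i < N.-1)%N -> delta * (4 * kappa * lmaxAtA A i) <= 1) ->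
  (forall i : 'I_N, 0 <= weight delta i) ->
  (forall i : 'I_N, gamma ^+ 2 * weight delta i * lmaxAtA A i
     + 4 * delta * kappa * L i ^+ 2 <= 4 * gamma * sigma i) ->
  (1 + delta) * energy N gamma T mu' <= energy N gamma Tk mu.
Proof.
move=> T Tk N0 n0 g0 k0 d0 muE vE hs hL hk hl w0 hw.
pose D i := dotp (T i.+1 - Tk i.+1) (T i.+1 - Tk i.+1).
pose X (i : 'I_N) := dotp (dx i) (dx i).
have X0 i : 0 <= X i by exact: dotp_ge0.
have TN : T N = 0 by exact: tail_oversize.
have TkN : Tk N = 0 by exact: tail_oversize.
have TdE : T N.-1.+1 - Tk N.-1.+1 = 0 by rewrite prednK // TN TkN subrr.
have AE i : A i *m dx i = T i - T i.+1.
  by rewrite /T [tail _ i]tail_rec addrK.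
pose S := \sum_(0 <= i < N.-1) dotp (T i.+1) (T i.+1).
pose Sk := \sum_(0 <= i < N.-1) dotp (Tk i.+1) (Tk i.+1).
pose SD := \sum_(0 <= i < N.-1) D i.
pose SL := \sum_i L i ^+ 2 * X i.
have mono : \sum_i sigma i * X i <= (dotp mu mu - dotp mu' mu') / (2 * gamma)
    + gamma * (Sk + S / 2 - dotp (T N.-1) (T N.-1) / 2 - SD / 4).
  rewrite /S /SD !mulr_suml.
  apply: le_trans (@admm_energy _ _ _ _ T Tk _ _ g0 muE).
  have -> : dotp (T 0%N) mu' = \sum_i dotp (A i *m dx i) mu'.
    by rewrite -dotp_suml.
  have -> : \sum_(0 <= i < N.-1) dotp (T i - T i.+1) (T i.+1 - Tk i.+1)
      = \sum_(i < N) dotp (T i - T i.+1) (T i.+1 - Tk i.+1).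
    rewrite (sum_nat_predr (fun i => dotp (T i - T i.+1) (T i.+1 - Tk i.+1))) //.
    by rewrite TdE [dotp _ 0]dotpC dotp0l addr0.
  rewrite mulr_sumr -big_split /=; apply: ler_sum => i _.
  apply: le_trans (hs i) _.
  by rewrite vE dotp_mulmxr trmxK AE dotpDr dotpZr.
(* Each [A_i^T mu'] splits into [v i] and a multiple of [A_i^T w]. The bound [hl] reduces the second
   part to [gamma ^+ 2 / 2 * SD]; divided by [2 * gamma] this is exactly the reserve
   [gamma * SD / 4] in [mono]. *)
have dual : delta * dotp mu' mu' <= 2 * (delta * kappa) * SL + gamma ^+ 2 / 2 * SD.
  apply: le_trans (ler_wpM2l d0 hk) _.
  have -> : SD = \sum_(i < N) D i.
    by rewrite (sum_nat_predr D) // /D TdE dotp0l addr0.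
  rewrite /SL !mulr_sumr -big_split /=; apply: ler_sum => i _.
  set w := T i.+1 - Tk i.+1.
  have atE : (A i)^T *m mu' = v i - gamma *: ((A i)^T *m w).
    by rewrite vE mulmxDr -scalemxAr addrK.
  have h1 : dotp ((A i)^T *m mu') ((A i)^T *m mu')
      <= 2 * (L i ^+ 2 * X i) + 2 * gamma ^+ 2 * (lmaxAtA A i * D i).
    have h2 := dotp_ge0 (v i + gamma *: ((A i)^T *m w)).
    have h3 := ler_wpM2l (sqr_ge0 gamma) (dotp_tr_mulmx_le (A i) w (n0 i)).
    have h4 := hL i.
    rewrite atE /D -/w /lmaxAtA; move: h2 h3 h4; rewrite -/(X i).
    set a := (A i)^T *m w; set l := lambda_max _.
    rewrite !dotp_lin [dotp a (v i)]dotpC; lra.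
  have h5 : delta * (4 * kappa * lmaxAtA A i) * D i <= D i.
    have [iN|iN] := ltnP i N.-1.
      by rewrite ler_piMl ?hl //; exact: dotp_ge0.
    (* The bound [hl] omits the last block, but there both tails are empty and [D i = 0]. *)
    have iE : i.+1 = N by have := ltn_ord i; lia.
    by rewrite /D iE TN TkN subrr dotp0l mulr0.
  have := ler_wpM2l (mulr_ge0 d0 (ltW k0)) h1.
  have := ler_wpM2l (sqr_ge0 gamma) h5.
  lra.
(* [T N.-1] consists of the last block alone, so its negative square in [mono] lowers the weight of
   that block; hence the [- 2] in [3 * N ^ 2 - 3 * N - 2]. *)
have tails : (3 + 2 * delta) * (2 * S) - 2 * dotp (T N.-1) (T N.-1)
    <= \sum_(i < N) weight delta i * (lmaxAtA A i * X i).
  have S_le := sum_tail_le (fun j => A j *m dx j).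
  rewrite -/T big_mkord (sum_nat_predr (fun i => dotp (T i.+1) (T i.+1))) // in S_le.
  rewrite prednK // TN dotp0l addr0 -/S in S_le.
  have T_last : dotp (T N.-1) (T N.-1)
      = \sum_(i < N) (i == N.-1 :> nat)%:R * dotp (A i *m dx i) (A i *m dx i).
    under eq_bigr do rewrite AE.
    rewrite (sum_nat_predr (fun i => (i == N.-1)%:R * dotp (T i - T i.+1) (T i - T i.+1))) //.
    rewrite eqxx prednK // TN subr0 mul1r big_nat big1 ?add0r // => i /andP[_ iN].
    by rewrite ltn_eqF // mul0r.
  apply: (@le_trans _ _ (\sum_(i < N) weight delta i * dotp (A i *m dx i) (A i *m dx i))).
    have -> : \sum_(i < N) weight delta i * dotp (A i *m dx i) (A i *m dx i)
        = (3 + 2 * delta) * (2 * \sum_(i < N) (coef i)%:R / 2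
            * dotp (A i *m dx i) (A i *m dx i)) - 2 * dotp (T N.-1) (T N.-1).
      rewrite T_last !mulr_sumr -sumrB; apply: eq_bigr => i _.
      by rewrite /weight; field.
    by rewrite lerD2r ler_wpM2l ?ler_wpM2l //; lra.
  by apply: ler_sum => i _; rewrite ler_wpM2l // dotp_mulmx_le.
have fin : gamma ^+ 2 * ((3 + 2 * delta) * (2 * S) - 2 * dotp (T N.-1) (T N.-1))
    + 4 * delta * kappa * SL <= 4 * gamma * \sum_i sigma i * X i.
  apply: le_trans (lerD (ler_wpM2l (sqr_ge0 gamma) tails) (lexx _)) _.
  rewrite /SL !mulr_sumr -big_split /=; apply: ler_sum => i _.
  by have := ler_wpM2r (X0 i) (hw i); lra.
rewrite /energy -/S -/Sk.
have [q qE] : exists q, dotp mu mu / (2 * gamma) = q by eexists.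
have [q' q'E] : exists q', dotp mu' mu' / (2 * gamma) = q' by eexists.
have mu'E : dotp mu' mu' = 2 * gamma * q' by rewrite -q'E; field; lra.
rewrite mulrBl qE q'E in mono; rewrite qE q'E; rewrite mu'E in dual.
have g4 : 0 < 4 * gamma by rewrite mulr_gt0.
(* Multiplied by [4 * gamma], [mono] combines with [fin] and [dual]: the squares of [T N.-1] and
   [SD] and the sum [SL] cancel, and [S] is left with the coefficient [1 + delta]. *)
by rewrite -(ler_pM2l g4); have := ler_wpM2l (ltW g4) mono; lra.
Qed.

(** * The bound on gamma and the rate delta2 *)

(** With [L = 0] the gradient would be constant, against strong monotonicity between 0 and a basis
    vector. This keeps the denominators in [delta2] positive. *)
Lemma lipschitz_constant_neq0 (R : realType) n (f : 'cV[R]_n -> R) sigma L :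
  (0 < n)%N -> closed_convex f -> 0 < sigma -> convexity_parameter f sigma ->
  lipschitz_gradient f L -> L != 0.
Proof.
move=> n0 cf s0 sf [df lf]; apply/eqP => L0.
have e0 : 0 < dotp (delta_mx (Ordinal n0) 0) (delta_mx (Ordinal n0) 0) :> R.
  rewrite dotp_gt0; apply/eqP => /matrixP/(_ (Ordinal n0) 0).
  by rewrite !mxE !eqxx => /eqP; rewrite oner_eq0.
move: e0; set e := delta_mx _ _ => e0.
have := lf e 0; rewrite L0 mul0r => g0.
have /eqP : enorm (gradient f e - gradient f 0) == 0 by rewrite eq_le g0 enorm_ge0.
move=> /eqP; rewrite -sqrf_eq0 enorm_sqr dotp_eq0 => /eqP ge0.
have := sf e 0 _ _ (gradient_subdifferential cf (df e)) (gradient_subdifferential cf (df 0)).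
by rewrite ge0 dotpC dotp0l enorm_sqr subr0 pmulr_rle0 // leNgt e0.
Qed.

(** For [d = 0] the ratio is [+oo], and the product form holds because it reads [0 < c]. *)
Lemma lt_ediv (R : realType) (g c d : R) :
  0 < c -> 0 <= d -> (g%:E < c%:E / d%:E)%E -> g * d < c.
Proof.
move=> c0 d0; have [->|dn0] := eqVneq d 0; first by rewrite mulr0.
by rewrite inver (negbTE dn0) -EFinM lte_fin ltr_pdivlMr // lt_def dn0.
Qed.

Lemma le_ediv (R : realType) (g c d : R) :
  0 <= c -> 0 <= d -> (g%:E <= c%:E / d%:E)%E -> g * d <= c.
Proof.
move=> c0 d0; have [->|dn0] := eqVneq d 0; first by rewrite mulr0.
by rewrite inver (negbTE dn0) -EFinM lee_fin ler_pdivlMr // lt_def dn0.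
Qed.

Lemma ediv_gt0 (R : realType) (c d : R) :
  0 < c -> 0 <= d -> (0 < c%:E / d%:E)%E.
Proof.
move=> c0 d0; have [->|dn0] := eqVneq d 0.
  by rewrite inve0 gt0_muley ?ltry // lte_fin.
by rewrite inver (negbTE dn0) -EFinM lte_fin divr_gt0 // lt_def dn0.
Qed.

Lemma coef_last N (hN : (2 < N)%N) : coef (last_block hN) = (N * (N - 1))%N.
Proof. by rewrite /coef /last_block /=; nia. Qed.

(** For [N > 2] the truncated subtractions are exact; the right-hand side is three times the [coef]
    of the last block. *)
Lemma gamma_coef_last N : (2 < N)%N ->
  (3 * N ^ 2 - 3 * N - 2 + 2 = 3 * (N * (N - 1)))%N.
Proof. by move=> hN; nia. Qed.

(** Each term of the minimum, once its denominator is cleared, is one requirement of [admm_descent]: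
    the first term serves block 1, [delta3] the inner blocks, [delta5] the last block, and [delta4]
    the bound on [delta]. The bound on [gamma] makes the numerators of [delta3] and [delta5]
    positive. *)
Lemma delta2_spec (R : realType) (N p : nat) (hN : (2 < N)%N) (n : 'I_N -> nat)
    (A : forall i : 'I_N, 'M[R]_(p, n i)) (sigma L : 'I_N -> R)
    (gamma kappa : R) (delta := delta2 hN A sigma L gamma kappa) :
  (forall i, 0 <= lmaxAtA A i) -> (forall i, L i != 0) ->
  (forall i, 0 < sigma i) -> 0 < kappa -> 0 < gamma ->
  (gamma%:E < gamma_max hN A sigma)%E ->
  [/\ 0 < delta,
      forall i : 'I_N, (i < N.-1)%N -> delta * (4 * kappa * lmaxAtA A i) <= 1
    & forall i : 'I_N, gamma ^+ 2 * weight delta i * lmaxAtA A i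
        + 4 * delta * kappa * L i ^+ 2 <= 4 * gamma * sigma i].
Proof.
have iNE : last_block hN = N.-1 :> nat by rewrite /= subn1.
have N1 : (0 < N.-1)%N by rewrite -iNE /= subn_gt0 ltnW.
move=> l0 L0 s0 k0 g0; set iN := last_block hN; set i1 := first_block hN.
have L20 i : 0 < L i ^+ 2 by rewrite exprn_even_gt0 //= L0.
have g20 : 0 < gamma ^+ 2 by rewrite exprn_gt0.
have c0 (i : 'I_N) : 0 <= (coef i)%:R :> R by rewrite ler0n.
pose cN : R := (3 * N ^ 2 - 3 * N - 2)%N%:R.
have cN0 : 0 <= cN by rewrite ler0n.
have cNE : cN = 3 * (N * (N - 1))%N%:R - 2.
  by rewrite -natrM -gamma_coef_last // natrD addrK.
rewrite /gamma_max lt_min => /andP[gi gN].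
have gi' i : inner i ->
    0 < 4 * sigma i * gamma - 3 * gamma ^+ 2 * (coef i)%:R * lmaxAtA A i.
  move: gi => /bigmin_gtP[_ gi] /gi /lt_ediv h.
  have := h _ _; rewrite !mulr_gt0 // !mulr_ge0 // => /(_ isT isT) {}h.
  by have := ltr_pM2l g0 (gamma * (3 * (coef i)%:R * lmaxAtA A i)) (4 * sigma i); rewrite h; lra.
have gN' : 0 < 4 * sigma iN * gamma - cN * gamma ^+ 2 * lmaxAtA A iN.
  move: gN => /lt_ediv h.
  have := h _ _; rewrite !mulr_gt0 // !mulr_ge0 // => /(_ isT isT) {}h.
  by have := ltr_pM2l g0 (gamma * (cN * lmaxAtA A iN)) (4 * sigma iN); rewrite h; lra.
have den0 i (c : R) : 0 <= c -> 0 < 2 * gamma ^+ 2 * c * lmaxAtA A i + 4 * kappa * L i ^+ 2.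
  move=> c0'; apply: ltr_wpDl; last by rewrite mulr_gt0 ?L20 // mulr_gt0.
  by rewrite !mulr_ge0 // ltW.
pose m := (Order.min (sigma i1 * gamma / (kappa * L i1 ^+ 2))%:E
      (Order.min (delta3 A sigma L gamma kappa)
        (Order.min (delta4 A kappa)
          (delta5 hN A sigma L gamma kappa)%:E)))%E.
have m0 : (0 < m)%E.
  rewrite !lt_min; apply/and4P; split.
  - by rewrite lte_fin divr_gt0 // mulr_gt0 ?L20.
  - apply/bigmin_gtP; split=> [|i ii]; first exact: ltry.
    by rewrite lte_fin divr_gt0 ?gi' ?den0.
  - apply/bigmin_gtP; split=> [|i ii]; first exact: ltry.
    by rewrite ediv_gt0 // mulr_ge0 // mulr_ge0 // ltW.
  - by rewrite lte_fin divr_gt0 // den0 // ler0n.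
(* The minimum is positive and at most its real first term, so [fine] returns its value. *)
have mfin : m = delta%:E.
  rewrite /delta /delta2 -/m fineK // fin_real // (lt_le_trans _ (ltW m0)) ?ltNyr //=.
  by rewrite /m gt_min ltry.
have := lexx m; rewrite {2}/m !le_min => /and4P[].
rewrite mfin => m1 m3 m4 m5; rewrite mfin lte_fin in m0; clear mfin m; clearbody delta.
split=> //.
- move=> i ii; apply: le_ediv => //; first by rewrite mulr_ge0 // mulr_ge0 // ltW.
  by move: m4 => /bigmin_geP[_]; apply.
move=> i; rewrite /weight.
(* For block 1 the weight is 0, and only the Lipschitz term remains. *)
have [i0|ip] := posnP i.
  have -> : i = i1 by apply/val_inj.
  have -> : coef i1 = 0%N by rewrite /coef /= muln0.
  have -> : (i1 == N.-1 :> nat) = false by exact: ltn_eqF.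
  move: m1; rewrite lee_fin ler_pdivlMr ?(mulr_gt0 k0 (L20 _)) //.
  by clear; rewrite /= !mulr0 subrr mulr0 mul0r add0r; lra.
have [iN'|] := ltnP i N.-1.
  have ii : inner i by rewrite /inner ip iN'.
  rewrite ltn_eqF //.
  move: m3 => /bigmin_geP[_ /(_ _ ii)].
  rewrite lee_fin ler_pdivlMr ?den0 // => m3.
  rewrite mulr0 subr0; move: m3; clear.
  by move: (lmaxAtA _ _) (coef i)%:R => l c; lra.
move=> Ni; have -> : i = iN.
  apply/val_inj; apply/eqP; rewrite [val iN]iNE eqn_leq Ni andbT -ltnS.
  by rewrite (ltn_predK hN) ltn_ord.
rewrite coef_last iNE eqxx.
move: m5; rewrite lee_fin ler_pdivlMr ?den0 ?ler0n // -/iN -/cN cNE mulr1.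
clear; move: (lmaxAtA _ _) (_ * _)%N%:R => l c; lra.
Qed.

(** * The ADMM iterates *)

(** The subproblem sees the residual with old blocks after [i]. It differs from the residual at
    [x k.+1] by the change of the tail after [i], and the dual update turns the latter residual into
    [lam k.+1]. *)
Lemma admm_subgradient (R : realType) (N p : nat) (n : 'I_N -> nat)
    (f : forall i, 'cV[R]_(n i) -> R) (A : forall i, 'M[R]_(p, n i))
    (b : 'cV[R]_p) (gamma : R)
    (x : nat -> forall i, 'cV[R]_(n i)) (lam : nat -> 'cV[R]_p) k i :
  (forall i, closed_convex (f i)) -> 0 <= gamma -> ADMM f A b gamma x lam ->
  subdifferential (f i) (x k.+1 i) ((A i)^T *m (lam k.+1 +
    gamma *: (tail (fun j => A j *m x k.+1 j) i.+1
              - tail (fun j => A j *m x k j) i.+1))).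
Proof.
move=> cf g0 admm; have [/(_ i) amin lamE] := admm k.
pose w (j : 'I_N) := if (j < i)%N then x k.+1 j else x k j.
pose c := \sum_(j < N | j != i) A j *m w j - b.
have res z : residual A b (dfwith w i z) = A i *m z + c.
  rewrite /residual (bigD1 i) //= dfwithin -addrA; congr (_ + (_ - _)).
  by apply: eq_bigr => j ji; rewrite dfwithout // eq_sym.
have := @argmin_subdifferential _ _ _ (f i) (A i) c (lam k) gamma (x k.+1 i) (cf i) g0.
have -> : lam k - gamma *: (A i *m x k.+1 i + c) = lam k.+1 +
    gamma *: (tail (fun j => A j *m x k.+1 j) i.+1
              - tail (fun j => A j *m x k j) i.+1).
  set d := tail _ _ - tail _ _.
  suff -> : A i *m x k.+1 i + c = residual A b (x k.+1) - d.
    by rewrite lamE scalerBr opprB addrA addrAC.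
  have -> : d = \sum_(j < N | j != i)
      if (i < j)%N then A j *m x k.+1 j - A j *m x k j else 0.
    rewrite -big_mkcondr /= /d /tail -sumrB; apply: eq_bigl => j.
    by rewrite andb_idl // => ij; rewrite neq_ltn ij orbT.
  have -> : residual A b (x k.+1)
      = A i *m x k.+1 i + (\sum_(j < N | j != i) A j *m x k.+1 j - b).
    by rewrite /residual (bigD1 i) //= addrA.
  rewrite -addrA [_ - b - _]addrAC -sumrB /c; congr (_ + (_ - _)).
  apply: eq_bigr => j ji; rewrite /w; case: ltngtP => [||ij].
  - by rewrite subr0.
  - by rewrite opprB addrCA subrr addr0.
  - by rewrite (val_inj ij) eqxx in ji.
apply => z /=.
have := amin z; rewrite /aug_lagrangian !res.
have sumf y : \sum_(j < N) f j (dfwith w i y j)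
    = f i y + \sum_(j < N | j != i) f j (w j).
  rewrite (bigD1 i) //= dfwithin; congr (_ + _).
  by apply: eq_bigr => j ji; rewrite dfwithout // eq_sym.
rewrite !sumf; clear; lra.
Qed.

(** The two sides use errors of opposite sign, which the squares ignore. *)
Lemma energy_lyapunov (R : realType) (N p : nat) (n : 'I_N -> nat)
    (A : forall i, 'M[R]_(p, n i)) (gamma : R) (xs x : forall i, 'cV[R]_(n i))
    (lams lam : 'cV[R]_p) :
  lyapunov A gamma xs lams x lam
  = energy N gamma (tail (fun j => A j *m (x j - xs j))) (lam - lams).
Proof.
rewrite /lyapunov /energy big_mkord enorm_sqr; congr (_ * _ + _); last first.
  by rewrite -opprB dotpNl dotpNr opprK mul1r mulrC.
apply: eq_bigr => i _; rewrite enorm_sqr.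
have -> : tail_sum A (fun j => xs j - x j) i = - tail (fun j => A j *m (x j - xs j)) i.+1.
  by rewrite /tail_sum /tail -sumrN; apply: eq_bigr => j _; rewrite -mulmxN opprB.
by rewrite dotpNl dotpNr opprK.
Qed.

Lemma tuple_norm_lyapunov (R : realType) (N p : nat) (n : 'I_N -> nat)
    (A : forall i, 'M[R]_(p, n i)) (gamma : R) (xs x : forall i, 'cV[R]_(n i))
    (lams lam : 'cV[R]_p) :
  tuple_norm gamma (tail_tuple A x lam - tail_tuple A xs lams)
  = Num.sqrt (lyapunov A gamma xs lams x lam).
Proof.
rewrite energy_lyapunov /energy big_mkord /tuple_norm /= enorm_sqr.
congr (Num.sqrt (_ * _ + _)); last by rewrite mul1r mulrC.
apply: eq_bigr => i _; rewrite enorm_sqr !ffunE.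
suff -> : tail_sum A x i - tail_sum A xs i = tail (fun j => A j *m (x j - xs j)) i.+1 by [].
by rewrite /tail_sum /tail -sumrB; apply: eq_bigr => j _; rewrite mulmxBr.
Qed.

(** Passes from the concatenated matrix, which defines kappa, to the blocks: both sides are the form
    of the sum of the [A_i A_i^T] at [mu]. *)
Lemma mxrow_gram (R : realType) (N p : nat) (n : 'I_N -> nat)
    (A : forall i, 'M[R]_(p, n i)) (mu : 'cV[R]_p) :
  dotp ((\mxrow_(i < N) A i)^T *m mu) ((\mxrow_(i < N) A i)^T *m mu)
  = \sum_i dotp ((A i)^T *m mu) ((A i)^T *m mu).
Proof.
rewrite dotp_mulmxl trmxK mulmxA tr_mxrow mul_mxrow_mxcol mulmx_suml dotp_sumr.
by apply: eq_bigr => i _; rewrite dotp_mulmxl trmxK mulmxA.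
Qed.

Theorem theorem3p2 (R : realType) (N p : nat) (hN : (2 < N)%N)
    (n : 'I_N -> nat) (hn : forall i, (0 < n i)%N)
    (A : forall i : 'I_N, 'M[R]_(p, n i)) (b : 'cV[R]_p)
    (f : forall i : 'I_N, 'cV[R]_(n i) -> R)
    (hf : forall i, closed_convex (f i))
    (sigma L : 'I_N -> R)
    (hsigma : forall i, 0 < sigma i)
    (hstrong : forall i, convexity_parameter (f i) (sigma i))
    (hlip : forall i, lipschitz_gradient (f i) (L i))
    (xs : forall i, 'cV[R]_(n i)) (lams : 'cV[R]_p)
    (hopt : Omega_star f A b xs lams)
    (hA : \mxrow_(i < N) A i != 0)
    (kappa : R) (hkappa : is_kappa (\mxrow_(i < N) A i) kappa)
    (gamma : R) (hgamma : 0 < gamma)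
    (hgamma_max : (gamma%:E < gamma_max hN A sigma)%E)
    (x : nat -> forall i, 'cV[R]_(n i)) (lam : nat -> 'cV[R]_p)
    (hADMM : ADMM f A b gamma x lam)
    (hrange : ~~ row_free (\mxrow_(i < N) A i) ->
       exists w, lam 0%N - lams = (\mxrow_(i < N) A i) *m w) :
  [/\ 0 < delta2 hN A sigma L gamma kappa,
      forall k : nat,
        lyapunov A gamma xs lams (x k) (lam k) >=
        (1 + delta2 hN A sigma L gamma kappa)
        * lyapunov A gamma xs lams (x k.+1) (lam k.+1)
    & Q_linear (tuple_norm gamma)
        (fun k => tail_tuple A (x k) (lam k)) (tail_tuple A xs lams)].
Proof.
have N0 : (0 < N)%N := ltn_trans (isT : (0 < 2)%N) hN.
have [k0 kappaP] := is_kappa_spec hA hkappa.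
have L0 i : L i != 0.
  exact: lipschitz_constant_neq0 (hn i) (hf i) (hsigma i) (hstrong i) (hlip i).
have l0 i : 0 <= lmaxAtA A i by apply: lambda_max_gram_ge0.
have [d0 d4 dw] := delta2_spec l0 L0 hsigma k0 hgamma hgamma_max.
have [hsub hfeas] := hopt.
set delta := delta2 _ _ _ _ _ _ in d0 d4 dw *.
pose T k := tail (fun j => A j *m (x k j - xs j)).
have muE k : lam k.+1 - lams = lam k - lams - gamma *: T k.+1 0%N.
  rewrite (hADMM k).2 addrAC /T tail0 /residual -hfeas -sumrB.
  by congr (_ - _ *: _); apply: eq_bigr => i _; rewrite mulmxBr.
(* Each dual update adds an element of the range of the concatenated matrix, so the dual error never
   leaves it and [kappaP] applies at every step. *)
have range k : ~~ row_free (\mxrow_(i < N) A i) ->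
    exists w, lam k - lams = \mxrow_(i < N) A i *m w.
  move=> Af; elim: k => [|k [w wE]]; first exact: hrange.
  exists (w - gamma *: \mxcol_(i < N) (x k.+1 i - xs i)).
  by rewrite muE wE mulmxBr -scalemxAr mul_mxrow_mxcol.
have descent k : (1 + delta) * lyapunov A gamma xs lams (x k.+1) (lam k.+1)
    <= lyapunov A gamma xs lams (x k) (lam k).
  rewrite !energy_lyapunov.
  (* The optimal point cancels in the difference of tails, so [v i] is the subgradient at [x k.+1 i]
     minus the one at [xs i]. *)
  have vE i : (A i)^T *m (lam k.+1 - lams + gamma *: (T k.+1 i.+1 - T k i.+1))
      = (A i)^T *m (lam k.+1 + gamma *: (tail (fun j => A j *m x k.+1 j) i.+1
          - tail (fun j => A j *m x k j) i.+1)) - (A i)^T *m lams.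
    rewrite -mulmxBr addrAC; congr (_ *m (_ + _ *: _ - _)).
    rewrite /T /tail -!sumrB; apply: eq_bigr => j _.
    by rewrite !mulmxBr opprB addrA subrK.
  apply: (admm_descent N0 hn hgamma k0 (ltW d0) (muE k) (fun i => erefl) _ _ _ d4 _ dw).
  - move=> i; rewrite -!enorm_sqr vE; apply: hstrong => //.
    exact: (admm_subgradient k hf (ltW hgamma) hADMM).
  - move=> i; rewrite -!enorm_sqr vE -exprMn lerXn2r ?nnegrE ?enorm_ge0 //.
    + exact: le_trans (enorm_ge0 _) ((hlip i).2 _ _).
    have [df lf] := hlip i; have := lf (x k.+1 i) (xs i).
    rewrite (subdifferential_gradient (df _) (admm_subgradient k hf (ltW hgamma) hADMM)).
    by rewrite (subdifferential_gradient (df _) (hsub i)).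
  - by rewrite -mxrow_gram; exact: kappaP (range _).
  - move=> i; rewrite /weight subr_ge0.
    (* Only the last block has the [- 2], and its [coef] is at least 1. *)
    case: eqP => [iN|_]; last by rewrite mulr0 mulr_ge0 // addr_ge0 // mulr_ge0 // ltW.
    have c1 : 1 <= (coef i)%:R :> R by rewrite ler1n /coef iN; nia.
    by rewrite mulr1; clear -c1 d0; nra.
split=> //.
(* The tuple norm is the square root of the Lyapunov function, so the rate is the square root of
   [(1 + delta)^-1]. *)
exists (Num.sqrt (1 + delta)^-1); split.
  rewrite sqrtr_gt0 invr_gt0 addr_gt0 //=.
  rewrite -[X in _ < X]sqrtr1 ltr_sqrt // invf_lt1 ?ltrDl // addr_gt0 //.
move=> k; rewrite !tuple_norm_lyapunov -sqrtrM ?invr_ge0 ?addr_ge0 ?(ltW d0) //.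
by rewrite ler_wsqrtr // mulrC ler_pdivlMr ?addr_gt0 // mulrC.
Qed.
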